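(* Let $r\ge 1$ be an integer and $k=4r$. Let $G_r$ be the following $k$-terminal digraph: start from the undirected $(r+2)\times(r+2)$ grid graph (vertices $(i,j)$, $1\le i,j\le r+2$, row $i$ counted from top, column $j$ from left, adjacent iff $|i-i'|+|j-j'|=1$); delete the four corner vertices; declare the remaining $4r$ boundary vertices to be the terminals (so there are $r$ terminals on each side) and all $r^2$ interior vertices non-terminals; delete every edge joining two terminals; finally orient every horizontal edge from left to right and every vertical edge from top to bottom. Then $G_r$ is acyclic and every reachability-preserving minor of $G_r$ contains at least $r^2=(k/4)^2$ non-terminal vertices. In particular, for infinitely many $k$ there is a $k$-terminal acyclic directed grid for which every reachability-preserving minor has $\Omega(k^2)$ non-terminals.
   Context: A minor of a digraph $G$ is any digraph obtained from $G$ by a sequence of vertex deletions, edge deletions and edge contractions (contracting a directed edge $(u,v)$ identifies $u$ and $v$ into one vertex, discarding loops), where terminals are never deleted and no contraction identifies two terminals. A digraph $H$ containing the terminal set $K$ is a reachability-preserving minor of $G$ if $H$ is a minor of $G$ and for all $x,x'\in K$ there is a directed path from $x$ to $x'$ in $H$ if and only if there is one in $G$. *)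

(* Defs.v *)
From mathcomp Require Import all_boot.
Set Implicit Arguments. Unset Strict Implicit. Unset Printing Implicit Defensive.

(* A digraph on a ground finite type T: a vertex set and an edge relation.
   Only edges between present vertices count (see [dedge]). *)
Record dgraph (T : finType) := DGraph { dv : {set T}; de : rel T }.

Definition dedge (T : finType) (G : dgraph T) : rel T :=
  fun x y => [&& x \in dv G, y \in dv G & de G x y].

Definition reach (T : finType) (G : dgraph T) (x y : T) : bool :=
  connect (dedge G) x y.

Definition acyclic (T : finType) (G : dgraph T) : Prop :=
  forall x y, dedge G x y -> ~~ reach G y x.

(* Elementary minor operations w.r.t. terminal set K.
   Contracting the edge between u and v identifies them; since at most one of
   them is a terminal, we may keep the identified vertex under the name u with
   v a non-terminal (this is just a choice of name for the merged vertex).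
   Loops are discarded. *)
Definition del_vertex (T : finType) (G : dgraph T) (v : T) : dgraph T :=
  DGraph (dv G :\ v) (de G).

Definition del_edge (T : finType) (G : dgraph T) (a b : T) : dgraph T :=
  DGraph (dv G) (fun x y => de G x y && ((x, y) != (a, b))).

Definition contract (T : finType) (G : dgraph T) (u v : T) : dgraph T :=
  DGraph (dv G :\ v)
    (fun x y => (x != y) &&
       [|| dedge G x y, (x == u) && dedge G v y | dedge G x v && (y == u)]).

Inductive minor_step (T : finType) (K : {set T}) (G : dgraph T) : dgraph T -> Prop :=
  | MS_delv v : v \in dv G -> v \notin K -> minor_step K G (del_vertex G v)
  | MS_dele a b : dedge G a b -> minor_step K G (del_edge G a b)
  | MS_contr u v : (dedge G u v || dedge G v u) -> v \notin K ->
      minor_step K G (contract G u v).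

Inductive minor (T : finType) (K : {set T}) (G : dgraph T) : dgraph T -> Prop :=
  | Min_refl : minor K G G
  | Min_step H H' : minor K G H -> minor_step K H H' -> minor K G H'.

Definition rp_minor (T : finType) (K : {set T}) (G H : dgraph T) : Prop :=
  minor K G H /\ K \subset dv H /\
  forall x y, x \in K -> y \in K -> reach H x y = reach G x y.

(* The grid G_r; coordinates 0..r+1 (paper's 1..r+2 shifted by one),
   first coordinate = row (from top), second = column (from left). *)
Definition gvert (r : nat) := ('I_r.+2 * 'I_r.+2)%type.

Definition is_corner (r : nat) (x : gvert r) : bool :=
  ((x.1 == 0 :> nat) || (x.1 == r.+1 :> nat)) &&
  ((x.2 == 0 :> nat) || (x.2 == r.+1 :> nat)).

Definition on_boundary (r : nat) (x : gvert r) : bool :=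
  [|| x.1 == 0 :> nat, x.1 == r.+1 :> nat, x.2 == 0 :> nat | x.2 == r.+1 :> nat].

Definition Kr (r : nat) : {set gvert r} :=
  [set x | on_boundary x && ~~ is_corner x].

Definition Vr (r : nat) : {set gvert r} := [set x | ~~ is_corner x].

Definition grid_arc (r : nat) (x y : gvert r) : bool :=
  ((x.1 == y.1) && (y.2 == x.2.+1 :> nat)) ||
  ((x.2 == y.2) && (y.1 == x.1.+1 :> nat)).

Definition Gr (r : nat) : dgraph (gvert r) :=
  DGraph (Vr r) (fun x y => grid_arc x y && ~~ ((x \in Kr r) && (y \in Kr r))).

(* Main.v *)
(** Let H be a reachability-preserving minor, and choose in H a path P_i from
    the i-th left to the i-th right terminal and a path Q_j from the j-th top to
    the j-th bottom terminal.  Replacing the vertices of H by their branch sets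
    turns P_i and Q_j into undirected walks of the grid crossing it from left to
    right and from top to bottom; such walks meet, so P_i and Q_j share a vertex
    z_ij of H.  It is not a terminal, because no terminal lies strictly between
    terminals for reachability.  Finally z_ij determines i and j: if z_ij also
    lies on P_i', then left i reaches right i', hence i <= i', and
    symmetrically. *)

Require Import Defs.
From mathcomp Require Import all_boot zify.

Set Implicit Arguments. Unset Strict Implicit. Unset Printing Implicit Defensive.

(** * Walks that cross a square of lattice points *)

Definition nadj (x y : nat * nat) : bool :=
  (x.1 == y.1) && ((y.2 == x.2.+1) || (x.2 == y.2.+1)) ||
  (x.2 == y.2) && ((y.1 == x.1.+1) || (x.1 == y.1.+1)).

(* Parity of the number of times the walk [x :: p] crosses the vertical ray
   going up from the point between [(a, b)] and [(a, b.+1)]. *)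
Fixpoint crossings (b a : nat) (x : nat * nat) (p : seq (nat * nat)) : bool :=
  if p is y :: p' then
    ((x.1 < a) && ((x.2 <= b) (+) (y.2 <= b))) (+) crossings b a y p'
  else false.

Lemma crossings0 b x p : crossings b 0 x p = false.
Proof. by elim: p x => //= y p IHp x; rewrite IHp. Qed.

(** Here the ray acts as a full vertical line, so the sum over the steps telescopes to the sides of
    the two ends. *)
Lemma crossings_all b a x p : all (fun y => y.1 < a) (x :: p) ->
  crossings b a x p = (x.2 <= b) (+) ((last x p).2 <= b).
Proof.
elim: p x => [|y p IHp] x /=; first by rewrite addbb.
by case/and3P=> -> ya pa; rewrite IHp /= ?ya // addbA addbK.
Qed.

(** Lengthening the ray by row [a] can only add a step between [(a, b)] and [(a, b.+1)], and such a
    step visits [(a, b)]. *)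
Lemma crossings_down b a x p : path nadj x p -> (a, b) \notin x :: p ->
  crossings b a.+1 x p = crossings b a x p.
Proof.
elim: p x => //= y p IHp x /andP[xy yp].
rewrite inE negb_or => /andP[abx abp]; rewrite (IHp _ yp abp); congr addb.
move: abp; rewrite inE negb_or => /andP[aby _].
case: x y xy abx aby {yp IHp} => [x1 x2] [y1 y2].
rewrite /nadj /= !xpair_eqE; lia.
Qed.

(* The walk enters and leaves the part of column [b.+1] above [(a, b.+1)] only
   through the two rays. *)
Lemma crossings_right b a x p : path nadj x p -> (a, b.+1) \notin x :: p ->
  crossings b a x p (+) crossings b.+1 a x p =
  ((x.1 < a) && (x.2 == b.+1)) (+)
  (((last x p).1 < a) && ((last x p).2 == b.+1)).
Proof.
elim: p x => [|y p IHp] x /=; first by rewrite addbb.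
case/andP=> xy yp; rewrite inE negb_or => /andP[abx abp].
move: (IHp _ yp abp); move: abp; rewrite inE negb_or => /andP[aby _].
case: x y xy abx aby {yp IHp} => [x1 x2] [y1 y2].
rewrite /nadj /= !xpair_eqE; move: (crossings b a _ p) (crossings b.+1 a _ p).
move: (_ && (_.2 == _)) => l c d; lia.
Qed.

(** A discrete Jordan curve argument: if the walks were disjoint, the parity seen from the current
    vertex of the second walk would stay constant, yet it is even at the top and odd at the
    bottom. *)
Lemma crossing_walks (n : nat) (x y : nat * nat) (p q : seq (nat * nat)) :
  path nadj x p -> path nadj y q ->
  x.2 = 0 -> (last x p).2 = n -> all (fun z => z.1 <= n) (x :: p) ->
  y.1 = 0 -> (last y q).1 = n -> all (fun z => z.2 <= n) (y :: q) ->
  has (mem (x :: p)) (y :: q).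
Proof.
move=> xp yq x0 pn pall y0 qn qall; apply/negPn/negP => /hasPn disj.
have {}disj z : z \in y :: q -> z \notin x :: p by move/disj.
(* One more step to the right puts the end of the first walk out of reach. *)
pose w := ((last x p).1, n.+1); pose p' := rcons p w.
have xp' : path nadj x p' by rewrite rcons_path xp /nadj /= pn !eqxx.
have disj' z : z \in y :: q -> z \notin x :: p'.
  move=> zq; rewrite /p' -rcons_cons mem_rcons inE negb_or disj // andbT.
  by apply/eqP=> zw; move/allP/(_ z zq): qall; rewrite zw ltnn.
have pall' : all (fun z => z.1 < n.+1) (x :: p').
  rewrite /p' -rcons_cons all_rcons pall andbT /= ltnS.
  exact: (allP pall _ (mem_last x p)).
have inv u v : u \in y :: q -> v \in y :: q -> nadj u v ->
    crossings u.2 u.1 x p' = crossings v.2 v.1 x p'.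
  have hor a b : (a, b.+1) \in y :: q ->
      crossings b a x p' = crossings b.+1 a x p'.
    (* The end terms vanish: the extended first walk starts in column [0] and ends in column [n.+1],
       whereas [b.+1 <= n]. *)
    move=> abq; have := crossings_right xp' (disj' _ abq).
    have := allP qall _ abq; rewrite /= last_rcons x0 /= => bn.
    by rewrite andbF eqn_leq [n < _]ltnNge bn andbF;
      case: (crossings b a x p') (crossings b.+1 a x p') => [] [].
  have ver a b : (a, b) \in y :: q ->
      crossings b a x p' = crossings b a.+1 x p'.
    by move=> abq; rewrite crossings_down ?disj'.
  case: u v => [u1 u2] [v1 v2] uq vq /orP[] /andP[/eqP /= e /orP[] /eqP /= e'];
    subst; by [exact: hor | exact/esym/hor | exact: ver | exact/esym/ver].
have inv_walk s u : path nadj u s -> {subset u :: s <= y :: q} ->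
    crossings u.2 u.1 x p' = crossings (last u s).2 (last u s).1 x p'.
  elim: s u => //= v s IHs u /andP[uv vs] sub.
  have uq : u \in y :: q by apply: sub; rewrite mem_head.
  have sub' : {subset v :: s <= y :: q}.
    by move=> z zs; apply: sub; rewrite inE zs orbT.
  by rewrite (inv u v uq (sub' v (mem_head _ _)) uv); apply: IHs.
(* In row [0] the ray is empty. In row [n] it may be lengthened to [n.+1], where it is a full line
   separating column [0] from column [n.+1]. *)
move: (inv_walk q y yq (fun z zq => zq)).
rewrite y0 crossings0 qn -crossings_down //; last first.
  by rewrite -{1}qn -surjective_pairing disj' ?mem_last.
rewrite crossings_all // x0 last_rcons /=.
by have /= := allP qall _ (mem_last y q); case: ltngtP; lia.
Qed.

(** * Directed reachability along paths *)

Lemma reach_head (T : finType) (G : dgraph T) (x y : T) :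
  reach G x y -> x != y -> exists z, dedge G x z.
Proof.
case/connectP=> [[|z p] /= xp ->]; first by rewrite eqxx.
by exists z; case/andP: xp.
Qed.

Lemma reach_last (T : finType) (G : dgraph T) (x y : T) :
  reach G x y -> x != y -> exists z, dedge G z y.
Proof.
case/connectP=> p; case/lastP: p => [|p z] /= xp ->; first by rewrite eqxx.
by move: xp; rewrite rcons_path last_rcons => /andP[_ ?]; exists (last x p).
Qed.

Lemma path_mem_reach (T : finType) (G : dgraph T) x p (z : T) :
  path (dedge G) x p -> z \in x :: p ->
  reach G x z && reach G z (last x p).
Proof.
move=> xp zp; case/splitPl: zp xp => p1 p2 <-.
rewrite cat_path last_cat => /andP[xp1 p2l]; apply/andP; split; apply/connectP.
- by exists p1.
- by exists p2.
Qed.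

(** * Branch sets of minors *)

Section BranchSets.

Variables (T : finType) (G : dgraph T).
Implicit Types (H : dgraph T) (S : {set T}) (B : T -> {set T}).

Definition uadj (x y : T) : bool := dedge G x y || dedge G y x.

(** Being a reflexive closure, [joined S x x] holds even for [x] outside [S]; hence the assumption
    [x \in S] in [joined_path]. *)
Definition joined S : rel T :=
  connect (fun x y => [&& x \in S, y \in S & uadj x y]).

Lemma uadjC x y : uadj x y = uadj y x.
Proof. by rewrite /uadj orbC. Qed.

Lemma joinedC S x y : joined S x y = joined S y x.
Proof. by apply: sym_connect_sym => a b; rewrite uadjC andbCA. Qed.

Lemma joinedS S S' x y : S \subset S' -> joined S x y -> joined S' x y.
Proof.
move=> /subsetP sSS'; apply: connect_sub => a b /and3P[aS bS ab].
by apply: connect1; rewrite !sSS'.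
Qed.

Lemma joined_edge S x a b y : joined S x a -> a \in S -> b \in S ->
  uadj a b -> joined S b y -> joined S x y.
Proof.
move=> xa aS bS ab; apply: connect_trans; apply: connect_trans xa _.
by apply: connect1; rewrite aS bS.
Qed.

Lemma joined_path S x y : x \in S -> joined S x y ->
  exists p, [/\ path uadj x p, last x p = y & {subset x :: p <= S}].
Proof.
move=> xS /connectP[p xp ->]; exists p; split=> //.
  by apply: sub_path xp => a b /and3P[].
move=> z; rewrite inE => /orP[/eqP->//|].
elim: p x xp {xS} => //= v p IHp x /andP[/and3P[_ vS _] vp].
by rewrite inE => /orP[/eqP->|/(IHp v vp)].
Qed.

(** The usual model of a minor, with orientation dropped: inside a contracted set, connection need
    not be directed, and the crossing argument needs only undirected walks. *)
Definition branch_sets H B : Prop :=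
  [/\ forall x, x \in dv H -> x \in B x,
      forall x y z, x \in dv H -> y \in dv H ->
        z \in B x -> z \in B y -> x = y,
      forall x a b, x \in dv H -> a \in B x -> b \in B x -> joined (B x) a b &
      forall x y, dedge H x y ->
        exists a b, [/\ a \in B x, b \in B y & uadj a b]].

Lemma branch_sets_sub H H' B : branch_sets H B -> dv H' \subset dv H ->
  (forall x y, dedge H' x y -> dedge H x y) -> branch_sets H' B.
Proof.
move=> [Bx Bdisj Bconn Bedge] /subsetP sV sE; split.
- by move=> x /sV; apply: Bx.
- by move=> x y z /sV xH /sV; apply: Bdisj.
- by move=> x a b /sV; apply: Bconn.
- by move=> x y /sE; apply: Bedge.
Qed.

(** The merged vertex keeps the name [u] and receives both branch sets, glued along an edge of [G]
    that realizes the contracted edge. *)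
Lemma branch_sets_contract H B u v : branch_sets H B ->
  dedge H u v || dedge H v u ->
  branch_sets (contract H u v) (fun x => if x == u then B u :|: B v else B x).
Proof.
move=> [Bx Bdisj Bconn Bedge] uv.
have [uH vH] : u \in dv H /\ v \in dv H by case/orP: uv => /and3P[].
have [a0 [b0 [a0u b0v ab0]]] : exists a b, [/\ a \in B u, b \in B v & uadj a b].
  by case/orP: uv => /Bedge [a [b [aB bB ab]]]; [exists a, b | exists b, a];
    rewrite ?[uadj b a]uadjC.
have sub x : B x \subset (if x == u then B u :|: B v else B x).
  by case: eqP => [->|_]; rewrite ?subsetUl.
split=> /=.
- by move=> x /setD1P[_ /Bx]; apply: (subsetP (sub x)).
- move=> x y z /setD1P[xv xH] /setD1P[yv yH].
  (* Vacuous: disjointness would force [w = v], but [v] has been removed. *)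
  have excl w : w != v -> w \in dv H -> z \in B v -> z \in B w -> w = u.
    by move=> wv wH zv zw; case/eqP: wv; apply: Bdisj zw zv.
  do 2![case: eqP => [->|?]] => //.
  + by case/setUP=> ? ?; [apply: (Bdisj _ _ z) | apply/esym/excl].
  + by move=> ? /setUP[] ?; [apply: (Bdisj _ _ z) | apply: excl].
  + exact: Bdisj.
- move=> x a b /setD1P[_ xH]; case: eqP => [_|_]; last exact: Bconn.
  have ju c d : c \in B u -> d \in B u -> joined (B u :|: B v) c d.
    by move=> cu du; apply: joinedS (subsetUl _ _) (Bconn u c d uH cu du).
  have jv c d : c \in B v -> d \in B v -> joined (B u :|: B v) c d.
    by move=> cu du; apply: joinedS (subsetUr _ _) (Bconn v c d vH cu du).
  have juv c d : c \in B u -> d \in B v -> joined (B u :|: B v) c d.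
    move=> cu dv; apply: (joined_edge (ju c a0 cu a0u) _ _ ab0 (jv b0 d b0v dv));
      by rewrite inE ?a0u ?b0v ?orbT.
  by case/setUP=> ? /setUP[] ?; [exact: ju | exact: juv | rewrite joinedC juv
    | exact: jv].
- move=> x y /and3P[/setD1P[xv xH] /setD1P[yv yH] /andP[_]].
  have lift c d : dedge H c d -> B c \subset (if x == u then B u :|: B v else B x) ->
    B d \subset (if y == u then B u :|: B v else B y) ->
    exists a b, [/\ a \in if x == u then B u :|: B v else B x,
      b \in if y == u then B u :|: B v else B y & uadj a b].
    move=> /Bedge[a [b [aB bB ab]]] /subsetP sc /subsetP sd.
    by exists a, b; split=> //; [apply: sc | apply: sd].
  case/or3P=> [xy|/andP[/eqP xu vy]|/andP[xv' /eqP yu]].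
  + exact: lift xy (sub x) (sub y).
  + by apply: lift vy _ (sub y); rewrite xu eqxx subsetUr.
  + by apply: lift xv' (sub x) _; rewrite yu eqxx subsetUr.
Qed.

(** Branch sets start as singletons; deletions keep them and contractions merge two. *)
Lemma minor_branch_sets (K : {set T}) H :
  minor K G H -> exists B, branch_sets H B.
Proof.
elim=> [|H1 H2 _ [B HB] [v vH vK | a b ab | u v uv vK]].
- exists (fun x => [set x]); split.
  + by move=> x _; rewrite inE.
  + by move=> x y z _ _ /set1P-> /set1P.
  + by move=> x a b _ /set1P-> /set1P->; apply: connect0.
  + by move=> x y xy; exists x, y; rewrite !inE /uadj xy.
- exists B; apply: branch_sets_sub HB _ _; first exact: subsetDl.
  by move=> x y /and3P[/setD1P[_ xH] /setD1P[_ yH] xy]; apply/and3P.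
- exists B; apply: branch_sets_sub HB _ _ => // x y.
  by case/and3P=> xH yH /andP[xy _]; apply/and3P.
- by eexists; apply: branch_sets_contract HB uv.
Qed.

(** The walk alternates connections inside branch sets with the edges linking consecutive ones. *)
Lemma branch_sets_path H B x p a b : branch_sets H B -> x \in dv H ->
  path (dedge H) x p -> a \in B x -> b \in B (last x p) ->
  joined (\bigcup_(z in [set z in x :: p]) B z) a b.
Proof.
case=> [_ _ Bconn Bedge]; elim: p x a => [|y p IHp] x a xH /=.
  move=> _ ax bx; apply: joinedS (Bconn x a b xH ax bx).
  by apply: (bigcup_sup x); rewrite !inE.
case/andP=> xy yp ax bl; have [c [d [cx dy cd]]] := Bedge _ _ xy.
have yH : y \in dv H by case/and3P: xy.
have sx : B x \subset \bigcup_(z in [set z in [:: x, y & p]]) B z.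
  by apply: (bigcup_sup x); rewrite !inE eqxx.
have sy : \bigcup_(z in [set z in y :: p]) B z \subset
          \bigcup_(z in [set z in [:: x, y & p]]) B z.
  apply/bigcupsP=> z; rewrite inE => zp.
  by apply: (bigcup_sup z); rewrite // !inE -in_cons zp orbT.
apply: (@joined_edge _ _ c d) => //.
- exact: joinedS sx (Bconn x a c xH ax cx).
- exact: (subsetP sx).
- by apply: (subsetP sy); apply/bigcupP; exists y; rewrite ?inE ?eqxx.
- exact: joinedS sy (IHp y d yH yp dy bl).
Qed.

End BranchSets.

(** * The grid and its terminals *)

Section Grid.

Variable r : nat.
Implicit Types (x y z : gvert r) (H : dgraph (gvert r)).

(** Counted by rows: the two extreme rows hold [r] terminals each, and each of the [r] inner rows
    holds its two ends. *)
Lemma card_Kr : #|Kr r| = 4 * r.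
Proof.
rewrite -sum1_card (eq_bigl (fun x => on_boundary x && ~~ is_corner x)); last first.
  by move=> x; rewrite inE.
rewrite big_mkcond /=.
rewrite (eq_bigr (fun x : gvert r => (fun a b : 'I_r.+2 =>
  nat_of_bool (on_boundary (a, b) && ~~ is_corner (a, b))) x.1 x.2)); last first.
  by move=> [a b] _ /=; case: ifP.
rewrite -(pair_bigA _ (fun a b : 'I_r.+2 =>
  nat_of_bool (on_boundary (a, b) && ~~ is_corner (a, b)))) /=.
have row (a : 'I_r.+2) : \sum_(b < r.+2)
    nat_of_bool (on_boundary (a, b) && ~~ is_corner (a, b)) =
    if (a == 0 :> nat) || (a == r.+1 :> nat) then r else 2.
  rewrite big_ord_recl big_ord_recr /=.
  case: ifP => ha.
    rewrite (eq_bigr (fun=> 1)) => [|b _]; last have := ltn_ord b;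
      rewrite ?sum1_card ?card_ord /on_boundary /is_corner /= /bump; lia.
  rewrite big1 => [|b _]; last have := ltn_ord b;
    rewrite /on_boundary /is_corner /= /bump; lia.
rewrite (eq_bigr _ (fun a _ => row a)) big_ord_recl big_ord_recr /=.
rewrite (eq_bigr (fun=> 2)) => [|b _]; last first.
  by have := ltn_ord b; rewrite /bump; case: ifP; lia.
rewrite sum_nat_const card_ord /bump; case: ifP; lia.
Qed.

Lemma dedge_arc x y : dedge (Gr r) x y -> grid_arc x y.
Proof. by case/and3P=> _ _ /andP[]. Qed.

Lemma grid_arc_ltn x y : grid_arc x y -> x.1 + x.2 < y.1 + y.2.
Proof. by case/orP=> /andP[/eqP-> /eqP->]; rewrite ?addnS ?addSn. Qed.

Lemma reach_leq x y : reach (Gr r) x y -> (x.1 <= y.1) && (x.2 <= y.2).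
Proof.
case/connectP=> p; elim: p x => [|z p IHp] x /=; first by move=> _ ->; rewrite !leqnn.
case/andP=> /dedge_arc xz zp yl; move: (IHp z zp yl).
by case/orP: xz => /andP[/eqP-> /eqP->]; lia.
Qed.

Lemma acyclic_Gr : acyclic (Gr r).
Proof.
move=> x y /dedge_arc/grid_arc_ltn xy; apply/negP => /reach_leq; lia.
Qed.

(** With corners and terminal-to-terminal arcs gone, top and left terminals have no incoming arc,
    right and bottom ones no outgoing arc. *)
Lemma terminal_not_between x y z :
  dedge (Gr r) x y -> dedge (Gr r) y z -> y \notin Kr r.
Proof.
case/and3P=> xV _ /andP[xy xyK] /and3P[_ zV /andP[yz yzK]].
apply/negP => yK; move: xyK yzK; rewrite yK andbT /=.
move: yK xV zV xy yz; case: x y z => [[x1 ?] [x2 ?]] [[y1 ?] [y2 ?]] [[z1 ?] [z2 ?]].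
rewrite !inE /on_boundary /is_corner /grid_arc -!val_eqE /= => yK xV zV xy yz.
by case/orP: xy yz => /andP[/eqP ? /eqP ?] /orP[] /andP[/eqP ? /eqP ?]; subst; lia.
Qed.

(** The shift to [i.+1] skips the corner; since [i.+1 < r.+2], [inord] never falls back on its
    default. *)
Definition left_t (i : 'I_r) : gvert r := (inord i.+1, ord0).
Definition right_t (i : 'I_r) : gvert r := (inord i.+1, ord_max).
Definition top_t (j : 'I_r) : gvert r := (ord0, inord j.+1).
Definition bottom_t (j : 'I_r) : gvert r := (ord_max, inord j.+1).

Lemma inordS (i : 'I_r) : (inord i.+1 : 'I_r.+2) = i.+1 :> nat.
Proof. by rewrite inordK // !ltnS ltnW. Qed.

Lemma inord0 : inord 0 = ord0 :> 'I_r.+2.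
Proof. by apply: val_inj; rewrite /= inordK. Qed.

Lemma inord_max : inord r.+1 = ord_max :> 'I_r.+2.
Proof. by apply: val_inj; rewrite /= inordK. Qed.

Lemma terminals_in (i : 'I_r) :
  [/\ left_t i \in Kr r, right_t i \in Kr r, top_t i \in Kr r
    & bottom_t i \in Kr r].
Proof.
by split; rewrite inE /on_boundary /is_corner /= inordS; have := ltn_ord i; lia.
Qed.

Lemma top_t_neq_left_t (j i : 'I_r) : top_t j != left_t i.
Proof. by rewrite xpair_eqE -!val_eqE /= inordS. Qed.

Lemma right_t_neq_bottom_t (i j : 'I_r) : right_t i != bottom_t j.
Proof.
by rewrite xpair_eqE -!val_eqE /= !inordS eqSS (ltn_eqF (ltn_ord i)).
Qed.

(** No arc of an inner row was deleted: its only terminals are its ends, which are not adjacent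
    because [i : 'I_r] forces [r > 0]. *)
Lemma reach_row (i : 'I_r) : reach (Gr r) (left_t i) (right_t i).
Proof.
have reach_c c : c <= r.+1 -> reach (Gr r) (left_t i) (inord i.+1, inord c).
  elim: c => [|c IHc] cr; first by rewrite inord0; exact: connect0.
  apply: connect_trans (IHc (ltnW cr)) (connect1 _).
  rewrite /dedge /= !inE /on_boundary /is_corner /grid_arc /= eqxx inordS.
  rewrite !inordK //; have := ltn_ord i; lia.
by have := reach_c r.+1 (leqnn _); rewrite inord_max.
Qed.

Lemma reach_column (j : 'I_r) : reach (Gr r) (top_t j) (bottom_t j).
Proof.
have reach_c c : c <= r.+1 -> reach (Gr r) (top_t j) (inord c, inord j.+1).
  elim: c => [|c IHc] cr; first by rewrite inord0; exact: connect0.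
  apply: connect_trans (IHc (ltnW cr)) (connect1 _).
  rewrite /dedge /= !inE /on_boundary /is_corner /grid_arc /= eqxx inordS.
  rewrite !inordK //; have := ltn_ord j; lia.
by have := reach_c r.+1 (leqnn _); rewrite inord_max.
Qed.

(** * Meeting vertices of row paths and column paths *)

Lemma joined_meet (S S' : {set gvert r}) x x' y y' :
  x \in S -> joined (Gr r) S x x' -> y \in S' -> joined (Gr r) S' y y' ->
  x.2 = 0 :> nat -> x'.2 = r.+1 :> nat -> y.1 = 0 :> nat ->
  y'.1 = r.+1 :> nat -> exists2 z, z \in S & z \in S'.
Proof.
move=> xS xx' yS' yy' x0 xr y0 yr.
have [p [xp xl pS]] := joined_path xS xx'.
have [q [yq yl qS']] := joined_path yS' yy'.
pose g (z : gvert r) : nat * nat := (val z.1, val z.2).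
have gI : injective g by move=> [a b] [c d] [/val_inj-> /val_inj->].
have gpath z s : path (uadj (Gr r)) z s -> path nadj (g z) (map g s).
  rewrite path_map; apply: sub_path => a b /orP[] /dedge_arc;
    by rewrite /grid_arc /nadj /= -!val_eqE /=; lia.
have := @crossing_walks r.+1 (g x) (g y) (map g p) (map g q) (gpath _ _ xp)
  (gpath _ _ yq) x0 _ _ y0 _ _.
rewrite !last_map xl yl -!map_cons !all_map => /(_ xr _ yr).
case/(_ _ _)/hasP.
- by apply/allP=> z _ /=; rewrite -ltnS.
- by apply/allP=> z _ /=; rewrite -ltnS.
move=> _ /mapP[z zq ->]; rewrite inE (mem_map gI) => zp.
by exists z; [exact: pS | exact: qS'].
Qed.

(** Recording reachability instead of the paths is enough for injectivity, and gives a boolean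
    predicate from which [xchoose] can pick. *)
Definition meeting H (i j : 'I_r) z : bool :=
  [&& z \in dv H :\: Kr r, reach H (left_t i) z, reach H z (right_t i),
      reach H (top_t j) z & reach H z (bottom_t j)].

Lemma meeting_exists H (i j : 'I_r) :
  rp_minor (Kr r) (Gr r) H -> exists z, meeting H i j z.
Proof.
case=> [/minor_branch_sets[B HB] [/subsetP KH rpH]].
have [lK rK _ _] := terminals_in i; have [_ _ tK bK] := terminals_in j.
have [Bx Bdisj _ _] := HB.
have := reach_row i; rewrite -rpH // => /connectP[p lp pr].
have := reach_column j; rewrite -rpH // => /connectP[q tq qb].
have sub x s z : x \in dv H -> path (dedge H) x s -> z \in x :: s -> z \in dv H.
  move=> xH xs; rewrite inE => /orP[/eqP->//|].
  elim: s x xs {xH} => //= v s IHs x /andP[/and3P[_ vS _] vp].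
  by rewrite inE => /orP[/eqP->|/(IHs v vp)].
have bL : right_t i \in B (last (left_t i) p) by rewrite -pr Bx ?KH.
have bT : bottom_t j \in B (last (top_t j) q) by rewrite -qb Bx ?KH.
have jP := branch_sets_path HB (KH _ lK) lp (Bx _ (KH _ lK)) bL.
have jQ := branch_sets_path HB (KH _ tK) tq (Bx _ (KH _ tK)) bT.
have [||//|//|//|//|w] := joined_meet _ jP _ jQ.
- by apply/bigcupP; exists (left_t i); rewrite ?Bx ?KH // !inE eqxx.
- by apply/bigcupP; exists (top_t j); rewrite ?Bx ?KH // !inE eqxx.
case/bigcupP=> z; rewrite inE => zp wz /bigcupP[z']; rewrite inE => zq wz'.
have zH := sub _ _ _ (KH _ lK) lp zp.
have e : z = z' by apply: Bdisj wz wz' => //; apply: sub tq zq; apply: KH.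
rewrite -{z'}e in zq wz'.
have /andP[lz zr] := path_mem_reach lp zp; have /andP[tz zb] := path_mem_reach tq zq.
exists z; rewrite /meeting inE zH lz tz pr zr qb zb !andbT.
apply/negP => zK; rewrite -pr -qb in zr zb; rewrite !rpH // in lz zr tz zb.
(* [z] cannot be both [left_t i] and [top_t j], so one of the two paths enters it by an arc;
   likewise one leaves it by an arc. *)
have [u uz] : exists u, dedge (Gr r) u z.
  have [e|] := eqVneq (left_t i) z; last exact: reach_last lz.
  apply: reach_last tz _; rewrite -e.
  exact: top_t_neq_left_t.
have [v zv] : exists v, dedge (Gr r) z v.
  have [e|] := eqVneq z (right_t i); last exact: reach_head zr.
  apply: reach_head zb _; rewrite e.
  exact: right_t_neq_bottom_t.
by move/negP: (terminal_not_between uz zv).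
Qed.

Lemma meeting_inj H (i j i' j' : 'I_r) z : rp_minor (Kr r) (Gr r) H ->
  meeting H i j z -> meeting H i' j' z -> (i, j) = (i', j').
Proof.
case=> [_ [_ rpH]] /and5P[_ lz zr tz zb] /and5P[_ lz' zr' tz' zb'].
(* A route through [z] joins two terminals, so it is reachability in the grid, where rows never
   decrease. Mixing the two meetings both ways gives equality. *)
have row (k l : 'I_r) : reach H (left_t k) z -> reach H z (right_t l) -> k <= l.
  have [lK _ _ _] := terminals_in k; have [_ rK _ _] := terminals_in l.
  move=> kz zl; have := connect_trans kz zl; rewrite -/(reach _ _ _) rpH //.
  by case/reach_leq/andP; rewrite /= !inordS.
have col (k l : 'I_r) : reach H (top_t k) z -> reach H z (bottom_t l) -> k <= l.
  have [_ _ tK _] := terminals_in k; have [_ _ _ bK] := terminals_in l.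
  move=> kz zl; have := connect_trans kz zl; rewrite -/(reach _ _ _) rpH //.
  by case/reach_leq/andP; rewrite /= !inordS.
congr (_, _); apply/val_inj/eqP; rewrite eqn_leq /=.
  by rewrite !row.
by rewrite !col.
Qed.

Lemma rp_minor_card H :
  rp_minor (Kr r) (Gr r) H -> r ^ 2 <= #|dv H :\: Kr r|.
Proof.
move=> rpH; pose f (u : 'I_r * 'I_r) := xchoose (meeting_exists u.1 u.2 rpH).
have fP u : meeting H u.1 u.2 (f u) by apply: xchooseP.
have fI : injective f.
  move=> [i j] [i' j'] e; apply: (meeting_inj rpH (fP (i, j))).
  by rewrite e; apply: fP (i', j').
rewrite (_ : r ^ 2 = #|[set: 'I_r * 'I_r]|); last first.
  by rewrite cardsT card_prod card_ord.
rewrite -(card_imset _ fI); apply/subset_leq_card/subsetP => _ /imsetP[u _ ->].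
by case/and5P: (fP u).
Qed.

End Grid.

Theorem theorem1p3 (r : nat) (hr : 1 <= r) :
  #|Kr r| = 4 * r /\ acyclic (Gr r) /\
  forall H : dgraph (gvert r), rp_minor (Kr r) (Gr r) H ->
    r ^ 2 <= #|dv H :\: Kr r|.
Proof.
by split; [exact: card_Kr | split; [exact: acyclic_Gr | exact: rp_minor_card]].
Qed.
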